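(* Let $P$ be an algebraically closed field, let $X=\{x_1,\ldots,x_n\}$ with $n\geq 1$, and let $P[X]=P[x_1,\ldots,x_n]$. Then the group $\mathrm{Aut}(\mathrm{End}(P[X]))$ of automorphisms of the semigroup $\mathrm{End}(P[X])$ is generated by semi-inner automorphisms.
   Context: $P[X]=P[x_1,\ldots,x_n]$ is the free commutative (associative, unital) algebra over $P$ on the finite set $X=\{x_1,\ldots,x_n\}$, i.e. the polynomial algebra. $\mathrm{End}(P[X])$ is the semigroup, under composition, of all (unital) $P$-algebra endomorphisms of $P[X]$; $\mathrm{Aut}(P[X])$ is the group of $P$-algebra automorphisms of $P[X]$; $\mathrm{Aut}(P)$ is the group of field automorphisms of $P$. A bijection $\mu:P[X]\to P[X]$ (of sets) generates $\tau\in\mathrm{Aut}(\mathrm{End}(P[X]))$ if $s^{\tau}=\mu s\mu^{-1}$ for every $s\in\mathrm{End}(P[X])$, where $s^\tau$ denotes the image of $s$ under $\tau$. For $\alpha\in\mathrm{Aut}(P)$, its natural extension to $P[X]$, also denoted $\alpha$, is the bijection $\alpha\left(\sum a_k u_k\right)=\sum\alpha(a_k)u_k$, where $a_k\in P$ and the $u_k$ are monomials in $x_1,\ldots,x_n$. An automorphism $\tau\in\mathrm{Aut}(\mathrm{End}(P[X]))$ is called semi-inner if it is generated by a bijection of the form $\mu=\alpha\eta$, where $\alpha$ is the natural extension to $P[X]$ of a field automorphism of $P$ and $\eta\in\mathrm{Aut}(P[X])$. *)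

(* Defs.v *)
From HB Require Import structures.
From mathcomp Require Import all_boot all_order all_algebra.
From mathcomp Require Import mpoly boolp.

Set Implicit Arguments.
Unset Strict Implicit.
Unset Printing Implicit Defensive.

Record semigroup_aut (S : semigroupType) := SemigroupAut {
  aut_fun :> {multiplicative S -> S};
  aut_inv : S -> S;
  autK : cancel aut_fun aut_inv;
  autVK : cancel aut_inv aut_fun }.

Section SemigroupAutGroup.
Variable S : semigroupType.
Implicit Types s t u : semigroup_aut S.

Lemma semigroup_autP s t : s =1 t -> s = t.
Proof.
case: s t => [[f [[fM]]] f' fK f'K] [[g [[gM]]] g' gK g'K] /= /funext fg.
have fg' : f' = g'.
  apply/funext => x; have <- : f' (f (g' x)) = g' x by exact: fK.
  by rewrite fg; congr f'; exact: esym (g'K x).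
move: fM fK f'K; rewrite {}fg {}fg' => fM fK f'K.
by rewrite (Prop_irrelevance fM gM) (Prop_irrelevance fK gK)
           (Prop_irrelevance f'K g'K).
Qed.

HB.instance Definition _ := gen_eqMixin (semigroup_aut S).
HB.instance Definition _ := gen_choiceMixin (semigroup_aut S).

Definition semigroup_aut_one : semigroup_aut S :=
  @SemigroupAut S idfun idfun (fun=> erefl) (fun=> erefl).

Definition semigroup_aut_mul s t : semigroup_aut S :=
  @SemigroupAut S (s \o t) (aut_inv t \o aut_inv s)
    (can_comp (@autK _ s) (@autK _ t)) (can_comp (@autVK _ t) (@autVK _ s)).

Lemma aut_inv_mul s : {morph aut_inv s : x y / (x * y)%g}.
Proof. by move=> x y; apply: (can_inj (@autK _ s)); rewrite gmulfM !autVK. Qed.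

HB.instance Definition _ s := isMultiplicative.Build S S (aut_inv s)
  (@aut_inv_mul s).

Definition semigroup_aut_inv s : semigroup_aut S :=
  @SemigroupAut S (aut_inv s) s (@autVK _ s) (@autK _ s).

Fact semigroup_aut_mulA : associative semigroup_aut_mul.
Proof. by move=> s t u; apply: semigroup_autP. Qed.

Fact semigroup_aut_mul1 : left_id semigroup_aut_one semigroup_aut_mul.
Proof. by move=> s; apply: semigroup_autP. Qed.

Fact semigroup_aut_mulr1 : right_id semigroup_aut_one semigroup_aut_mul.
Proof. by move=> s; apply: semigroup_autP. Qed.

Fact semigroup_aut_mulV :
  left_inverse semigroup_aut_one semigroup_aut_inv semigroup_aut_mul.
Proof. by move=> s; apply: semigroup_autP => x; exact: autK. Qed.

Fact semigroup_aut_mulrV :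
  right_inverse semigroup_aut_one semigroup_aut_inv semigroup_aut_mul.
Proof. by move=> s; apply: semigroup_autP => x; exact: autVK. Qed.

HB.instance Definition _ := isGroup.Build (semigroup_aut S)
  semigroup_aut_mulA semigroup_aut_mul1 semigroup_aut_mulr1
  semigroup_aut_mulV semigroup_aut_mulrV.

End SemigroupAutGroup.

(* Membership in the smallest subgroup of G containing A.  By classical logic, *)
(* letting H range over boolean predicates covers all subgroups of G.          *)
Definition generated (G : groupType) (A : G -> Prop) (x : G) : Prop :=
  forall H : {pred G}, group_closed H -> (forall a, A a -> a \in H) -> x \in H.

Definition mpoly_end (n : nat) (P : fieldType) :=
  {lrmorphism {mpoly P[n]} -> {mpoly P[n]}}.

Section MpolyEnd.
Variables (n : nat) (P : fieldType).

Lemma mpoly_endP (s t : mpoly_end n P) : s =1 t -> s = t.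
Proof.
case: s t => [f [[fA] [fM] [fZ]]] [g [[gA] [gM] [gZ]]] /= /funext fg.
move: fA fM fZ; rewrite {}fg => fA fM fZ.
by rewrite (Prop_irrelevance fA gA) (Prop_irrelevance fM gM)
           (Prop_irrelevance fZ gZ).
Qed.

HB.instance Definition _ := gen_eqMixin (mpoly_end n P).
HB.instance Definition _ := gen_choiceMixin (mpoly_end n P).

Definition mpoly_end_mul (s t : mpoly_end n P) : mpoly_end n P := s \o t.

Fact mpoly_end_mulA : associative mpoly_end_mul.
Proof. by move=> s t u; apply: mpoly_endP. Qed.

HB.instance Definition _ := isSemigroup.Build (mpoly_end n P) mpoly_end_mulA.

Definition generates (mu : {mpoly P[n]} -> {mpoly P[n]})
    (tau : semigroup_aut (mpoly_end n P)) : Prop :=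
  exists nu : {mpoly P[n]} -> {mpoly P[n]},
    [/\ cancel mu nu, cancel nu mu &
        forall s : mpoly_end n P, tau s =1 mu \o s \o nu].

Definition semi_inner (tau : semigroup_aut (mpoly_end n P)) : Prop :=
  exists (alpha : {rmorphism P -> P}) (eta : mpoly_end n P),
    [/\ bijective alpha, bijective eta & generates (map_mpoly alpha \o eta) tau].

End MpolyEnd.

(* Main.v *)
Require Import Defs.
From HB Require Import structures.
From mathcomp Require Import all_boot all_order all_algebra.
From mathcomp Require Import mpoly boolp ring zify.

(** Every automorphism [tau] of the semigroup is itself semi-inner.  An
endomorphism [s] is the same thing as the polynomial self-map
[act s : v |-> (s 'X_i).@[v]] of the affine space [P^n], composition being
reversed.  The constant maps are the elements [z] with [s * z = z] for all
[s], so [tau] permutes them; this yields a bijection [mu] of [P^n] such that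
[act (tau s) = mu \o act s \o mu^-1] ([act_aut]).  One has to show that [mu]
is a field automorphism followed by a polynomial automorphism.

Let [e] be the [tau]-image of the projection onto the [i0]-th coordinate axis.
It is an idempotent whose image is the set [C = mu(axis)].  The heart of the
proof is that [C] is polynomially isomorphic to a line: [act e = phi \o t] with
[t] in [P[X]], [phi] a polynomial curve and [t \o phi = id] ([axis_section]).
Put [R = {r | e r = r}], the ring of functions on [C].

- A nonzero [r] in [R] has finitely many zeros on [C]: through [mu], zero sets
  in [C] become zero sets on the axis of one-variable polynomials.  Hence
  composition with a nonconstant polynomial curve lying in [C] embeds [R] into
  [P[s]] ([along_arc_inj]), where any two elements are algebraically dependent.
- [P[X]] is factorial ([factorial_mpoly]).  Take [f] in [R], nonzero, vanishing
  at a point of [C].  One of its prime factors [p] has an image [t = e p]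
  vanishing there too.  For [r] in [R], algebraic dependence gives a nonzero
  polynomial [H] such that [f], hence [p], divides [H(r)], a product of factors
  [r - c] as [P] is algebraically closed.  So [p] divides some [r - c], and
  applying [e], [t] divides [r - c] in [R].  By descent on the degree,
  [R = P[t]] ([retract_generator]).

Now [nu = t \o mu] restricted to the axis is a bijection of [P] that conjugates
one-variable polynomials to polynomials.  As it then normalises the affine
group, it has the form [a * alpha + b] for a field automorphism [alpha]
([conj_poly_semi_affine]).  Factoring scalar functions through the axis and
through [C] shows that both [alpha^-1 \o mu] and [mu^-1 \o alpha] are
polynomial, which is the claim ([aut_semi_inner]). *)

Set Implicit Arguments.
Unset Strict Implicit.
Unset Printing Implicit Defensive.
Import GRing.Theory Pdiv.Idomain.
Local Open Scope ring_scope.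

(** * Factorial domains and polynomials over them *)

Section Factorial.
Variable A : idomainType.
Implicit Types a b p x y : A.

Definition divides p x := exists d, x = d * p.

Definition prime_elt p :=
  [/\ p != 0, p \isn't a GRing.unit &
      forall a b, divides p (a * b) -> divides p a \/ divides p b].

(** The number of primes is recorded because it decreases when a prime is
cancelled, which makes the extraction of contents terminate. *)
Inductive prime_product : nat -> A -> Prop :=
| PrimeProductUnit u : u \is a GRing.unit -> prime_product 0 u
| PrimeProductMul k p x :
    prime_elt p -> prime_product k x -> prime_product k.+1 (p * x).

Definition factorial_dom := forall x, x != 0 -> exists k, prime_product k x.

Lemma prime_product_unitM k u x :
  u \is a GRing.unit -> prime_product k x -> prime_product k (u * x).
Proof.
move=> Uu; elim=> [v Uv|{}k p {}x pp _ IH]; last by rewrite mulrCA; constructor.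
by constructor; rewrite unitrM Uu.
Qed.

Lemma prime_product_mul k l x y :
  prime_product k x -> prime_product l y -> prime_product (k + l) (x * y).
Proof.
move=> ppx ppy; elim: ppx => [u Uu|{}k p {}x pp _ IH].
  exact: prime_product_unitM.
by rewrite addSn -mulrA; constructor.
Qed.

(** A prime dividing a product of primes is associated with one of them, so
it can be cancelled at the cost of exactly one factor. *)
Lemma prime_product_div k p x :
  prime_elt p -> prime_product k (p * x) ->
  exists2 j, k = j.+1 & prime_product j x.
Proof.
move=> pp; move Ez: (p * x) => z ppz.
case: (pp) => p0 pU pdiv.
elim: ppz x Ez => [u Uu x Ex|{}k q {}z qq ppz IH x Ex].
  by move: Uu; rewrite -Ex unitrM (negbTE pU).
case: (qq) => q0 qU qdiv.
have [] : divides q p \/ divides q x.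
- by apply: qdiv; exists z; rewrite Ex mulrC.
- case=> b Eb; have [[c qE]|[c bE]] : divides p q \/ divides p b.
  + by apply: pdiv; exists 1; rewrite mul1r mulrC [RHS]Eb mulrC.
  + exists k => //.
    have cb1 : c * b = 1.
      by apply: (mulfI p0); rewrite mulr1 [RHS]Eb qE; ring.
    have -> : x = c * z.
      have bxz : b * x = z.
        by apply: (mulfI q0); rewrite -Ex Eb mulrCA mulrA.
      by rewrite -bxz mulrA cb1 mul1r.
    by apply: prime_product_unitM => //; apply/unitrPr; exists b.
  + case/negP: qU; apply/unitrPr; exists c.
    by apply: (mulfI p0); rewrite mulr1 [RHS]Eb bE; ring.
- case=> d xE; have [|j -> ppj] := IH d.
    by apply: (mulfI q0); rewrite -Ex xE; ring.
  exists j.+1 => //; rewrite xE mulrC; by constructor.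
Qed.

End Factorial.

Section FactorialPoly.
Variable A : idomainType.
Hypothesis Afact : factorial_dom A.
Implicit Types (a c p : A) (f g h q : {poly A}).

(** If a prime constant divides [g * h], it divides the product of the leading
coefficients, hence one of them; the corresponding leading term can then be
dropped without affecting divisibility. *)
Lemma prime_eltC a : prime_elt a -> prime_elt a%:P.
Proof.
case=> a0 aU adiv; split; first by rewrite polyC_eq0.
  rewrite poly_unitE size_polyC a0 coefC /= ; exact: aU.
move=> g h; have [k] := ubnP (size g + size h).
elim: k g h => // k IH g h ltk dgh.
have [->|g0] := eqVneq g 0; first by left; exists 0; rewrite mul0r.
have [->|h0] := eqVneq h 0; first by right; exists 0; rewrite mul0r.
have drop f : f != 0 -> divides a (lead_coef f) ->
    exists f', [/\ f = f' + (f - f'), (size f' < size f)%N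
                  & divides a%:P (f - f')].
  move=> f0 [c fE]; exists (f - lead_coef f *: 'X^((size f).-1)); split.
  - by ring.
  - rewrite [X in (_ < X)%N](polySpred f0) ltnS; apply/leq_sizeP => j.
    rewrite leq_eqVlt coefB coefZ coefXn => /predU1P[<-|lt].
      by rewrite eqxx mulr1 lead_coefE subrr.
    rewrite gtn_eqF // mulr0 subr0 nth_default //.
    by rewrite (leq_trans _ lt) // leqSpred.
  - exists (c *: 'X^((size f).-1)); rewrite opprB addrC subrK fE.
    by rewrite mulrC -mul_polyC -mul_polyC polyCM; ring.
have [] : divides a (lead_coef g) \/ divides a (lead_coef h).
- apply: adiv; case: dgh => w /(congr1 lead_coef).
  by rewrite !lead_coefM lead_coefC => ->; exists (lead_coef w).
- case/(drop _ g0) => g' [gE lt [w wE]].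
  have [||[v vE]|] := IH g' h.
  + by rewrite -ltnS (leq_trans _ ltk) // ltnS ltn_add2r.
  + case: dgh => v vE; exists (v - w * h).
    by rewrite mulrBl -vE mulrAC -wE; ring.
  + by left; exists (v + w); rewrite gE wE vE mulrDl.
  + by right.
- case/(drop _ h0) => h' [hE lt [w wE]].
  have [|||[v vE]] := IH g h'.
  + by rewrite -ltnS (leq_trans _ ltk) // ltnS ltn_add2l.
  + case: dgh => v vE; exists (v - w * g).
    by rewrite mulrBl -vE mulrAC -wE; ring.
  + by left.
  + right; exists (v + w); by rewrite hE wE vE mulrDl.
Qed.

Definition primitive_poly f := forall a, prime_elt a -> ~ divides a%:P f.

(** The form of Gauss's lemma used to turn a divisibility up to a nonzero
scalar, that is over the field of fractions, into a genuine one. *)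
Lemma primitive_cancel f h c q :
  primitive_poly f -> c != 0 -> c%:P * h = q * f -> divides f h.
Proof.
move=> fprim /Afact[k ppc]; elim: ppc h q => [u Uu|{}k p x pp _ IH] h q E.
  exists (u^-1%:P * q); rewrite -mulrA -E mulrA -polyCM mulVr // mul1r //.
have [[q' q'E]|/(fprim _ pp)//] : divides p%:P q \/ divides p%:P f.
  case: (prime_eltC pp) => _ _; apply; exists (x%:P * h).
  by rewrite -E polyCM; ring.
apply: (IH h q'); case: pp => p0 _ _.
have pC0 : p%:P != 0 by rewrite polyC_eq0.
apply: (mulfI pC0); rewrite mulrA -polyCM E q'E; ring.
Qed.

(** Prime constants dividing [f] divide its leading coefficient, so only
finitely many can be extracted. *)
Lemma primitive_part f : f != 0 ->
  exists c g, [/\ c != 0, f = c%:P * g & primitive_poly g].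
Proof.
move=> f0; have /Afact[k ppk] : lead_coef f != 0 by rewrite lead_coef_eq0.
elim: k f f0 ppk => [|k IH] f f0 ppk;
  (have [prim|] := EM (primitive_poly f);
   first by exists 1, f; rewrite oner_neq0 mul1r);
  move=> /existsNP[a /not_implyP[pa /contrapT[g fE]]];
  move: (ppk); rewrite fE lead_coefM lead_coefC mulrC;
  move=> /(prime_product_div pa)[j // [Ej] ppj].
have g0 : g != 0 by move: f0; rewrite fE mulf_eq0 negb_or => /andP[].
rewrite -Ej in ppj; have [c [h [c0 gE prim]]] := IH g g0 ppj.
exists (a * c), h; split=> //; last by rewrite gE polyCM; ring.
by case: pa => a0 _ _; rewrite mulf_neq0.
Qed.

Lemma primitive_unit c g : primitive_poly (c%:P * g) -> c != 0 ->
  c \is a GRing.unit.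
Proof.
move=> prim /Afact[k ppc]; case: ppc prim => // {}k p x pp _ /(_ p pp) [].
by exists (x%:P * g); rewrite polyCM; ring.
Qed.

(** If [f] divides [g * h], consider the pseudo-gcd [d] of [f] and [g], whose
primitive part [d'] divides [f] and [g].  By irreducibility either [f] is
associated with [d'], or [f] and [g] are coprime over the field of fractions and
a Bezout relation multiplied by [h] shows that [f] divides [h] up to a
scalar. *)
Lemma primitive_irreducible_prime f :
    primitive_poly f -> (1 < size f)%N ->
    (forall g h, f = g * h -> (size g <= 1)%N \/ (size h <= 1)%N) ->
  prime_elt f.
Proof.
move=> fprim f1 firr.
have f0 : f != 0 by rewrite -size_poly_gt0 ltnW.
split=> //; first by rewrite poly_unitE negb_and; rewrite neq_ltn f1 orbT.
move=> g h [w ghE].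
pose d := gcdp f g.
have d0 : d != 0 by rewrite gcdp_eq0 negb_and f0.
have [c1 [d' [c10 dE d'prim]]] := primitive_part d0.
have dvdd' x : d %| x -> divides d' x.
  case/dvdpP=> -[c q] /= c0 E.
  apply: (@primitive_cancel _ _ c (q * c1%:P)) => //.
  by rewrite mul_polyC E dE; ring.
have [q fE] := dvdd' f (dvdp_gcdl f g).
have [sq|sd'] := firr q d' fE.
- left; move: fE; rewrite (size1_polyC sq); set b := q`_0 => fE.
  have b0 : b != 0 by apply: contraNneq f0 => b0; rewrite fE b0 mul0r.
  have bU : b \is a GRing.unit.
    by rewrite fE in fprim; apply: primitive_unit fprim b0.
  have [e gE] := dvdd' g (dvdp_gcdr f g).
  exists (e * b^-1%:P); rewrite gE fE.
  by rewrite mulrA -[e * _ * _]mulrA -polyCM mulVr // mulr1.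
- right; have : coprimep f g.
    rewrite coprimep_def -/d dE mul_polyC size_scale // eqn_leq sd'.
    rewrite size_poly_gt0; apply: contraNneq f0 => d'0.
    by rewrite fE d'0 mulr0.
  case/Bezout_coprimepP=> -[u v] /= /eqpP[[c2 c3]] /= /andP[c20 c30] E.
  apply: (@primitive_cancel f h c3 (c2%:P * (u * h + v * w))) => //.
  have -> : c3%:P = c2%:P * (u * f + v * g).
    by rewrite mul_polyC E -mul_polyC mulr1.
  transitivity (c2%:P * (u * h * f + v * (g * h))); first by ring.
  by rewrite ghE; ring.
Qed.

Lemma factorial_poly : factorial_dom {poly A}.
Proof.
move=> f f0; have [m] := ubnP (size f); elim: m f f0 => // m IHm f f0 ltm.
have /Afact[k ppk] : lead_coef f != 0 by rewrite lead_coef_eq0.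
have [c [g [c0 fE gprim]]] := primitive_part f0.
have /Afact[l ppl] := c0.
have ppc : prime_product l c%:P.
  elim: ppl => [u Uu|? p x pp _ IH]; first by constructor; rewrite rmorph_unit.
  by rewrite polyCM; constructor=> //; apply: prime_eltC.
have g0 : g != 0 by apply: contraNneq f0; rewrite fE => ->; rewrite mulr0.
suff [j ppg] : exists j, prime_product j g.
  by exists (l + j)%N; rewrite fE; apply: prime_product_mul.
have ltg : (size g < m.+1)%N by move: ltm; rewrite fE mul_polyC size_scale.
have [s1|s1] := leqP (size g) 1.
  exists 0; constructor; move: gprim g0; rewrite (size1_polyC s1) => gprim g0.
  rewrite rmorph_unit //; apply: (@primitive_unit _ 1); first by rewrite mulr1.
  by rewrite polyC_eq0 in g0.
have [irr|] := EM (forall u v, g = u * v -> (size u <= 1)%N \/ (size v <= 1)%N).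
  exists 1; rewrite -[g]mulr1; constructor; last by constructor; rewrite unitr1.
  exact: primitive_irreducible_prime.
move=> /existsNP[u /existsNP[v /not_implyP[gE /not_orP[/negP su /negP sv]]]].
rewrite -!ltnNge in su sv.
have [u0 v0] : u != 0 /\ v != 0.
  by split; rewrite -size_poly_gt0 ltnW.
move: ltg; rewrite gE size_mul // => ltg.
have [i ppu] : exists i, prime_product i u.
  apply: IHm => //; move: ltg; case: (size v) sv => [|[|s]] // _.
  by rewrite addnS /= ltnS addnS; apply: leq_ltn_trans; rewrite leq_addr.
have [j ppv] : exists i, prime_product i v.
  apply: IHm => //; move: ltg; case: (size u) su => [|[|s]] // _.
  by rewrite addSn /= ltnS addSn; apply: leq_ltn_trans; rewrite leq_addl.
by exists (i + j)%N; apply: prime_product_mul.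
Qed.

End FactorialPoly.

(** * Multivariate polynomials: factoriality and evaluation *)

Lemma factorial_iso (A B : idomainType) (f : {rmorphism A -> B})
    (g : {rmorphism B -> A}) :
  cancel f g -> cancel g f -> factorial_dom B -> factorial_dom A.
Proof.
move=> fK gK Bfact x x0.
have /Bfact[k ppk] : f x != 0 by rewrite -(rmorph0 f) (can_eq fK).
exists k; rewrite -(fK x); elim: ppk => [u Uu|{}k p y [p0 pU pdiv] _ IH].
  by constructor; rewrite rmorph_unit.
rewrite rmorphM; constructor=> //; split.
- by rewrite -(rmorph0 g) (can_eq gK).
- by apply: contra pU => /(rmorph_unit f); rewrite gK.
- move=> a b [d dE].
  have [] : divides p (f a) \/ divides p (f b).
  + by apply: pdiv; exists (f d); rewrite -rmorphM dE rmorphM gK.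
  + by case=> e eE; left; exists (g e); rewrite -rmorphM -eE fK.
  + by case=> e eE; right; exists (g e); rewrite -rmorphM -eE fK.
Qed.

Section MpolyPoly.
Variables (R : idomainType) (n : nat).

Definition mpoly_of_poly : {rmorphism {poly {mpoly R[n]}} -> {mpoly R[n.+1]}} :=
  horner_eval 'X_ord_max \o map_poly (@mwiden n R).

Definition mnm_init (m : 'X_{1..n.+1}) : 'X_{1..n} :=
  [multinom m (widen_ord (leqnSn n) i) | i < n].

Lemma muni_monomial m : muni 'X_[R, m] = 'X_[R, mnm_init m] *: 'X^(m ord_max).
Proof. by rewrite muniE msuppX big_seq1 mcoeffX eqxx scale1r. Qed.

Lemma muni_mwiden p : muni (@mwiden n R p) = p%:P.
Proof.
elim/mpolyind: p => [|c m p _ _ IH]; first by rewrite mwiden0 muni0.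
rewrite mwidenD muniD IH mwidenZ muniZ mwidenX muni_monomial mnmwiden_ordmax.
rewrite expr0 [_ *: 1]alg_polyC -mul_polyC -polyCM mul_mpolyC polyCD.
congr (_%:P + _); congr (_ *: 'X_[_]).
by apply/mnmP=> i; rewrite mnmE mnmwiden_widen.
Qed.

Lemma muniK : cancel (@muni n R) mpoly_of_poly.
Proof.
move=> p; elim/mpolyind: p => [|c m p _ _ IH]; first by rewrite muni0 rmorph0.
rewrite muniD rmorphD.
apply: (f_equal2 +%R); last exact: IH.
rewrite muniZ muni_monomial.
rewrite -!mul_polyC !rmorphM rmorphXn /= /horner_eval.
rewrite !map_polyC map_polyX !hornerC hornerX /= mwidenC mwidenX.
rewrite mpolyXn -mpolyXD mul_mpolyC; congr (_ *: 'X_[_]).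
apply/mnmP=> i; rewrite mnmDE mulmnE mnmE.
case: (unliftP ord_max i) => [j ->|->].
  have -> : lift ord_max j = widen_ord (leqnSn n) j.
    by apply: val_inj; exact: lift_max.
  rewrite mnmwiden_widen mnmE -val_eqE /= gtn_eqF ?ltn_ord //.
  by rewrite mul0n addn0.
by rewrite mnmwiden_ordmax eqxx mul1n.
Qed.

Lemma mpoly_of_polyK : cancel mpoly_of_poly (@muni n R).
Proof.
move=> p; elim/poly_ind: p => [|p c IH]; first by rewrite rmorph0 muni0.
rewrite rmorphD rmorphM muniD muniM IH /= /horner_eval.
rewrite map_polyC map_polyX hornerC hornerX /= muni_mwiden muni_monomial.
congr (_ * _ + _).
rewrite mnm1E eqxx expr1 (_ : mnm_init _ = 0%MM) ?mpolyX0 ?scale1r //.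
by apply/mnmP=> i; rewrite mnmE mnm1E mnm0E -val_eqE /= gtn_eqF.
Qed.

End MpolyPoly.

Lemma factorial_mpoly (F : fieldType) (n : nat) : factorial_dom {mpoly F[n]}.
Proof.
elim: n => [|n IH].
  move=> p p0; exists 0; constructor; have pE : p = (p@_0)%:MP.
    apply: msize1_polyC; rewrite msizeE; apply/bigmax_leqP_seq=> m _ _.
    by rewrite mdegE big_ord0.
  by rewrite pE mpolyC_eq0 -unitfE in p0 *; rewrite rmorph_unit.
apply: (factorial_iso (@muniK F n) (@mpoly_of_polyK F n)).
exact: factorial_poly.
Qed.

Section ClosedField.
Variable P : closedFieldType.

(** An algebraically closed field is infinite. *)
Lemma poly_eq0_horner (p : {poly P}) : (forall x, p.[x] = 0) -> p = 0.
Proof.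
move=> p0; apply/eqP/negPn/negP => /closed_nonrootP[x].
by rewrite /root p0 eqxx.
Qed.

Lemma eq_poly_horner (p q : {poly P}) : (forall x, p.[x] = q.[x]) -> p = q.
Proof.
move=> pq; apply/eqP; rewrite -subr_eq0; apply/eqP/poly_eq0_horner => x.
by rewrite hornerD hornerN pq subrr.
Qed.

Lemma meval_muni n (p : {mpoly P[n.+1]}) (v : 'I_n -> P) (x : P) :
  (map_poly (meval v) (muni p)).[x] =
  p.@[fun i => if unlift ord_max i is Some j then v j else x].
Proof.
elim/mpolyind: p => [|c m p _ _ IH]; first by rewrite muni0 !rmorph0 horner0.
rewrite muniD mevalD rmorphD hornerD.
apply: (f_equal2 +%R); last exact: IH.
rewrite mevalZ muniZ muni_monomial.
rewrite -!mul_polyC !rmorphM.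
rewrite /= map_polyXn !map_polyC /=.
rewrite !hornerM !hornerC hornerXn mevalC.
congr (_ * _); rewrite !mevalX big_ord_recr /= unlift_none; congr (_ * _).
apply: eq_bigr => i _; rewrite mnmE.
have -> : widen_ord (leqnSn n) i = lift ord_max i.
  by apply: val_inj; exact/esym/lift_max.
by rewrite liftK.
Qed.

Lemma mpoly_eq0_meval n (p : {mpoly P[n]}) : (forall v, p.@[v] = 0) -> p = 0.
Proof.
elim: n p => [p p0|n IH p p0].
  have pE : p = (p@_0)%:MP.
    apply: msize1_polyC; rewrite msizeE; apply/bigmax_leqP_seq=> m _ _.
    by rewrite mdegE big_ord0.
  by have := p0 (fun=> 0); rewrite pE mevalC => ->.
rewrite -[p]muniK; suff -> : muni p = 0 by rewrite rmorph0.
apply/polyP=> i; rewrite coef0; apply: IH => v.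
rewrite -(coef_map (meval v)) [map_poly _ _]poly_eq0_horner ?coef0 // => x.
by rewrite meval_muni.
Qed.

Lemma eq_mpoly_meval n (p q : {mpoly P[n]}) :
  (forall v, p.@[v] = q.@[v]) -> p = q.
Proof.
move=> pq; apply/eqP; rewrite -subr_eq0; apply/eqP.
by apply: mpoly_eq0_meval => v; rewrite mevalB pq subrr.
Qed.
End ClosedField.

(** * Algebraic dependence *)

Section BivariateEval.
Variable F : fieldType.

(** The value at [(a, b)] of the bivariate polynomial [S], whose outer variable
is sent to [a] and whose inner one is sent to [b]. *)
Definition eval2 (A : comAlgType F) (a b : A) (S : {poly {poly F}}) : A :=
  (map_poly (horner_alg b) S).[a].

Lemma eval2_morph (A B : comAlgType F) (g : {rmorphism A -> B}) (a b : A) S :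
  (forall c : F, g c%:A = c%:A) -> g (eval2 a b S) = eval2 (g a) (g b) S.
Proof.
move=> gA; have galg h : g (horner_alg b h) = horner_alg (g b) h.
  elim/poly_ind: h => [|h c IH]; first by rewrite !rmorph0.
  by rewrite !rmorphD !rmorphM IH /= !horner_algX !horner_algC gA.
rewrite /eval2 -horner_map -map_poly_comp; congr (_.[_]).
by apply: eq_map_poly => h /=.
Qed.

(** The [N ^ 2] products [f ^+ i * r ^+ j] with [i, j < N] lie in a space whose
dimension is only linear in [N]. *)
Lemma poly_algebraic_dependence (f r : {poly F}) :
  exists2 S, S != 0 & eval2 f r S = 0.
Proof.
pose a := (size f).-1; pose b := (size r).-1; pose N := (a + b).+2.
pose D := ((a + b) * N).+1.
(* the pair of exponents is encoded by quotient and remainder of k by N *)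
pose E (k : 'I_(N * N)) : {poly F} := f ^+ (k %/ N) * r ^+ (k %% N).
pose M := \matrix_(k < N * N) poly_rV (E k) : 'M[F]_(N * N, D).
have sizeE k : (size (E k) <= D)%N.
  have kN : (k %/ N < N)%N by rewrite ltn_divLR // ltn_ord.
  have kN' : (k %% N < N)%N by rewrite ltn_mod.
  have [sf sr] := (size_poly_exp_leq f (k %/ N), size_poly_exp_leq r (k %% N)).
  apply: leq_trans (size_polyMleq _ _) _.
  rewrite -/a -/b in sf sr.
  suff : (a * (k %/ N) + b * (k %% N) <= (a + b) * N)%N by rewrite /D; lia.
  by rewrite mulnDl leq_add // leq_mul // ltnW.
have kerM : kermx M != 0.
  rewrite -mxrank_eq0 mxrank_ker subn_eq0 -ltnNge.
  apply: leq_ltn_trans (rank_leq_col _) _; rewrite /D /N; nia.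
have /rowV0Pn[u /sub_kermxP uM u0] := kerM.
have [k0 uk0] : exists k0, u 0 k0 != 0.
  by have /rV0Pn := u0.
pose S : {poly {poly F}} :=
  \sum_(k < N * N) (u 0 k *: 'X^(k %% N)) *: 'X^(k %/ N).
exists S.
  apply: contraNneq uk0 => S0.
  suff <- : S`_(k0 %/ N)`_(k0 %% N) = u 0 k0 by rewrite S0 !coef0.
  rewrite !coef_sum (bigD1 k0) //= big1 => [|k kk0].
    by rewrite addr0 coefZ coefXn eqxx mulr1 coefZ coefXn eqxx mulr1.
  rewrite coefZ coefXn; case: eqP => [E1|_]; last by rewrite mulr0 coef0.
  rewrite mulr1 coefZ coefXn; case: eqP => [E2|_]; last by rewrite mulr0.
  case/eqP: kk0; apply: val_inj.
  by rewrite /= (divn_eq k N) (divn_eq k0 N) -E1 -E2.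
rewrite /eval2 rmorph_sum horner_sum /=.
transitivity (\sum_(k < N * N) u 0 k *: E k).
  apply: eq_bigr => k _.
  rewrite map_polyZ map_polyXn hornerZ hornerXn /= linearZ /= rmorphXn /=.
  by rewrite horner_algX -scalerAl mul1r -scalerAl mulrC.
apply/polyP=> i; rewrite coef0 coef_sum.
have [iD|Di] := ltnP i D.
  have := congr1 (fun B : 'rV_D => B 0 (Ordinal iD)) uM; rewrite !mxE => uM0.
  by rewrite -[RHS]uM0; apply: eq_bigr => k _; rewrite coefZ !mxE.
by rewrite big1 // => k _; rewrite coefZ nth_default ?mulr0 // (leq_trans _ Di).
Qed.

(** After cancelling powers of [a], the part of the relation free of [a] is
nonzero and is a multiple of [a]. *)
Lemma eval2_divides (A : comAlgType F) (a b : A) S :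
    GRing.lreg a -> S != 0 -> eval2 a b S = 0 ->
  exists2 H : {poly F}, H != 0 & exists d, horner_alg b H = d * a.
Proof.
move=> areg; elim/poly_ind: S => [|S c IH]; first by rewrite eqxx.
rewrite /eval2 rmorphD rmorphM /= map_polyX map_polyC hornerD hornerMX hornerC.
rewrite -/(eval2 a b S) /=.
have [->|c0 _ E] := eqVneq c 0; last first.
  exists c => //; exists (- eval2 a b S).
  by apply/eqP; rewrite mulNr -addr_eq0 addrC E.
rewrite rmorph0 addr0 mulf_eq0 polyX_eq0 orbF => S0 E; apply: IH => //.
by apply: areg; rewrite mulr0 mulrC -[RHS]E rmorph0 addr0.
Qed.

End BivariateEval.

Lemma horner_alg_split (P : closedFieldType) (A : comAlgType P) (b : A)
    (H : {poly P}) :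
  exists s : seq P,
    horner_alg b H = (lead_coef H)%:A * \prod_(c <- s) (b - c%:A).
Proof.
have [s {1}->] := closed_field_poly_normal H; exists s.
rewrite -mul_polyC rmorphM rmorph_prod /= horner_algC; congr (_ * _).
by apply: eq_bigr => c _; rewrite rmorphB /= horner_algX horner_algC.
Qed.

Lemma prime_divides_prod (A : idomainType) (p : A) (I : eqType) (s : seq I)
    (x : I -> A) :
  prime_elt p -> divides p (\prod_(i <- s) x i) ->
  exists2 i, i \in s & divides p (x i).
Proof.
case=> p0 pU pdiv; elim: s => [|i s IH].
  rewrite big_nil => -[d E]; case/negP: pU.
  by apply/unitrPr; exists d; rewrite mulrC.
rewrite big_cons => /pdiv[di|/IH[j js dj]].
  by exists i; rewrite ?mem_head.
by exists j; rewrite // in_cons js orbT.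
Qed.

(** Used with [f] the evaluation at a point, to select a prime factor vanishing
there. *)
Lemma prime_product_divisor (A B : idomainType) (f : {rmorphism A -> B}) k x :
  prime_product k x -> f x = 0 ->
  exists p, [/\ prime_elt p, f p = 0 & divides p x].
Proof.
elim=> [u Uu fu0|{}k p {}x pp _ IH].
  by have := rmorph_unit f Uu; rewrite fu0 unitr0.
rewrite rmorphM => /eqP; rewrite mulf_eq0.
case/orP=> [/eqP fp0|/eqP/IH[q [pq fq0 [d ->]]]].
  by exists p; split=> //; exists x; rewrite mulrC.
by exists q; split=> //; exists (p * d); rewrite mulrA.
Qed.

(** * One-dimensional retracts of a polynomial ring *)

Section Retract.
Variables (P : closedFieldType) (n : nat) (e : mpoly_end n P).
Hypothesis e_idem : forall p, e (e p) = e p.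
(** This says that the image of the retraction has dimension at most one. *)
Hypothesis e_dep : forall f r, e f = f -> e r = r ->
  exists2 S, S != 0 & eval2 f r S = 0.

Lemma mpolyC_alg c : c%:A = c%:MP_[n] :> {mpoly P[n]}.
Proof. by rewrite -mul_mpolyC mulr1. Qed.

Lemma end_mpolyC (s : mpoly_end n P) c : s c%:MP = c%:MP.
Proof. by rewrite -mpolyC_alg linearZ rmorph1. Qed.

(** A prime of [P[X]] need not lie in the retract [R = {r | e r = r}] and its
image under [e] need not be prime in [P[X]]; but divisibility by [p] implies,
after applying [e], divisibility by [t = e p] inside [R].  The prime is chosen
so that [t] vanishes at a point of the image of [e], hence is not constant. *)
Lemma retract_uniformizer (f0 : {mpoly P[n]}) :
    e f0 = f0 -> (1 < msize f0)%N ->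
  exists t, [/\ e t = t, (1 < msize t)%N &
    forall r, e r = r -> exists c d, [/\ e d = d & r = c%:MP + d * t]].
Proof.
move=> ef0 f0_gt1.
(* evaluation at the image of the origin under the retraction *)
pose at0 : {rmorphism {mpoly P[n]} -> P} := meval (fun=> 0) \o e.
have at0C c : at0 c%:MP = c by rewrite /= end_mpolyC mevalC.
pose f := f0 - (at0 f0)%:MP.
have ef : e f = f.
  by rewrite rmorphB; congr (_ - _); [exact: ef0|exact: end_mpolyC].
have f_neq0 : f != 0.
  rewrite subr_eq0; apply: contraTneq f0_gt1 => ->.
  by rewrite msizeC -leqNgt; case: eqP.
have [k ppk] := factorial_mpoly f_neq0.
have [|p [pp p0 [d0 fE]]] := prime_product_divisor (f := at0) ppk.
  by rewrite rmorphB [X in _ - X]at0C subrr.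
have t0 : e p != 0.
  by apply: contraNneq f_neq0 => ep0; rewrite -ef fE rmorphM /= ep0 mulr0.
have et0 : at0 (e p) = 0 by rewrite -[RHS]p0 /= e_idem.
exists (e p); split=> //.
  rewrite ltnNge; apply: contra t0 => /msize1_polyC tE.
  by move: et0; rewrite tE at0C => ->; rewrite mpolyC0.
move=> r er; have [S S0 E] := e_dep ef er.
have freg : GRing.lreg f by apply/lregP.
have [H H0 [d HE]] := eval2_divides freg S0 E.
have [s sE] := horner_alg_split r H.
have : divides p (horner_alg r H) by exists (d * d0); rewrite HE fE mulrA.
rewrite sE mpolyC_alg; case: (pp) => _ pU pdiv.
case/pdiv => [[u uE]|/(prime_divides_prod pp)[c _ [u uE]]].
  case/negP: pU; apply/unitrPr; exists ((lead_coef H)^-1%:MP * u).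
  by rewrite mulrCA mulrC [p * u]mulrC -uE -mpolyCM mulfV ?lead_coef_eq0.
exists c, (e u); split=> //.
have -> : e u * e p = r - c%:MP.
  rewrite -rmorphM -uE mpolyC_alg rmorphB; congr (_ - _); first exact: er.
  exact: end_mpolyC.
by rewrite addrC subrK.
Qed.

(** Since [t] is not constant, dividing [r - c] by [t] lowers the total degree,
and the quotient stays in the retract. *)
Lemma retract_generator (f0 : {mpoly P[n]}) :
    e f0 = f0 -> (1 < msize f0)%N ->
  exists t, [/\ e t = t, (1 < msize t)%N &
    forall r, e r = r -> exists g : {poly P}, r = horner_alg t g].
Proof.
move=> ef0 f0_gt1; have [t [et t_gt1 tdiv]] := retract_uniformizer ef0 f0_gt1.
exists t; split=> // r; have [m] := ubnP (msize r).
elim: m r => // m IH r ltm er.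
have t0 : t != 0 by rewrite -msize_poly_eq0 -lt0n ltnW.
have [c [d [ed rE]]] := tdiv r er.
have [d0|d0] := eqVneq d 0.
  by exists c%:P; rewrite rE d0 mul0r addr0 horner_algC mpolyC_alg.
have [|g dE] := IH d _ ed; last first.
  exists (c%:P + g * 'X).
  by rewrite rE rmorphD rmorphM /= horner_algC horner_algX -dE mpolyC_alg.
have dtE : d * t = r - c%:MP by rewrite rE addrC addKr.
have sdt : msize (d * t) = (msize d + (msize t).-1)%N.
  by rewrite msizeM // -[in LHS](prednK (ltnW t_gt1)) addnS.
have d_gt0 : (0 < msize d)%N by rewrite lt0n msize_poly_eq0.
have : (msize (d * t) <= maxn (msize r) (msize (c%:MP_[n])))%N.
  rewrite dtE; apply: leq_trans (mmeasureD_le _ _ _) _; by rewrite mmeasureN.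
have : (msize (c%:MP_[n]) <= 1)%N by rewrite msizeC; case: eqP.
move: ltm; rewrite sdt; lia.
Qed.

End Retract.

(** * Bijections of the field that conjugate polynomials to polynomials *)

Lemma rmorphism_of_morph (A B : nzRingType) (f : A -> B) :
  {morph f : x y / x + y} -> {morph f : x y / x * y} -> f 1 = 1 ->
  exists g : {rmorphism A -> B}, f =1 g.
Proof.
move=> fD fM f1.
have f0 : f 0 = 0 by apply: (addrI (f 0)); rewrite -fD !addr0.
have fB : {morph f : x y / x - y}.
  by move=> x y; apply: (addIr (f y)); rewrite -fD !subrK.
pose fa := GRing.isZmodMorphism.Build A B f fB.
pose fm := GRing.isMonoidMorphism.Build A B f (f1, fM).
pose g : {rmorphism A -> B} := HB.pack f fa fm.
by exists g.
Qed.

Section SemiAffine.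
Variables (P : closedFieldType) (nu nu' : P -> P).
Hypotheses (nuK : cancel nu nu') (nu'K : cancel nu' nu).
Hypothesis nu_poly :
  forall g : {poly P}, exists g' : {poly P}, forall y, nu g.[y] = g'.[nu y].

(** The conjugate of an affine bijection and that of its inverse are mutually
inverse polynomials, so both have degree one. *)
Lemma conj_affine (a b : P) : a != 0 ->
  exists u w, u != 0 /\ forall y, nu (a * y + b) = u * nu y + w.
Proof.
move=> a0; have [g gE] := nu_poly (a%:P * 'X + b%:P).
have [h hE] := nu_poly (a^-1%:P * ('X - b%:P)).
have gh : g \Po h = 'X.
  apply: eq_poly_horner => x; rewrite horner_comp hornerX -[x]nu'K -hE -gE.
  by rewrite !hornerE /= divff // mul1r subrK.
have := size_comp_poly g h; rewrite gh size_polyX /= => /esym/eqP.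
rewrite muln_eq1 => /andP[/eqP sg _].
have g2 : size g = 2 by move: sg; case: (size g) => [|[|[|]]].
exists g`_1, g`_0; split=> [|y].
  have := lead_coefE g; rewrite g2 => <-.
  by rewrite lead_coef_eq0 -size_poly_gt0 g2.
have := gE y; rewrite !hornerE => ->.
by rewrite horner_coef g2 !big_ord_recl big_ord0 /= expr0 mulr1 addr0 addrC.
Qed.

(** Nontrivial translations are the affine bijections without fixed point, a
property invariant under conjugation. *)
Lemma conj_translation (b : P) : exists w, forall y, nu (y + b) = nu y + w.
Proof.
have [u [w [u0 uE]]] := conj_affine b (oner_neq0 P).
exists w => y; have [u1|u1] := eqVneq u 1.
  by have := uE y; rewrite u1 !mul1r.
have [b0|b0] := eqVneq b 0.
  have E z : nu z = u * nu z + w by have := uE z; rewrite b0 mul1r addr0.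
  have := E (nu' 0); have := E (nu' 1).
  rewrite !nu'K mulr0 mulr1 add0r => E1 w0.
  by move: E1 u1; rewrite -w0 addr0 => <-; rewrite eqxx.
(* w / (1 - u) is the fixed point of z |-> u * z + w *)
have du : 1 - u != 0 by rewrite subr_eq0 eq_sym.
have := uE (nu' (w / (1 - u))); rewrite nu'K mul1r => E.
suff /(can_inj nuK)/eqP : nu (nu' (w / (1 - u)) + b) = nu (nu' (w / (1 - u))).
  by rewrite -subr_eq0 addrAC subrr add0r (negbTE b0).
by rewrite E nu'K; field.
Qed.

(** Normalised to fix 0 and 1, [nu] is additive because it conjugates
translations to translations, and multiplicative because it conjugates
homotheties to homotheties. *)
Lemma conj_poly_semi_affine :
  exists (alpha : {rmorphism P -> P}) (a b : P),
    a != 0 /\ forall y, nu y = a * alpha y + b.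
Proof.
pose b := nu 0; pose a := nu 1 - nu 0.
have a0 : a != 0 by rewrite subr_eq0 (can_eq nuK) oner_neq0.
pose f y := (nu y - b) / a.
have f0 : f 0 = 0 by rewrite /f subrr mul0r.
have f1 : f 1 = 1 by rewrite /f divff.
have nuE y : nu y = a * f y + b by rewrite /f mulrC mulfVK // subrK.
have fD : {morph f : x y / x + y}.
  move=> x y; have [w wE] := conj_translation y.
  have := wE 0; rewrite add0r => yE.
  by rewrite /f wE yE /b; field.
have fM : {morph f : x y / x * y}.
  move=> x y; have [->|x0] := eqVneq x 0; first by rewrite mul0r f0 mul0r.
  have [u [w [u0 uE]]] := conj_affine 0 x0.
  have E0 := uE 0; have E1 := uE 1; have Ey := uE y.
  rewrite mulr0 addr0 in E0; rewrite mulr1 addr0 in E1; rewrite addr0 in Ey.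
  rewrite /f Ey E1 /b; move: E0; rewrite -/b => E0.
  have -> : w = b - u * b by rewrite [X in X - _]E0; ring.
  rewrite (_ : nu 1 = a + b); last by rewrite /a /b subrK.
  by field.
have [alpha alphaE] := rmorphism_of_morph fD fM f1.
by exists alpha, a, b; split=> // y; rewrite -alphaE.
Qed.

End SemiAffine.

(** * Endomorphisms as polynomial self-maps of the affine space *)

Section EndPoints.
Variables (P : closedFieldType) (n : nat).
Local Notation point := ('I_n -> P).
Implicit Types (s t z : mpoly_end n P) (v w : point).

Definition act s v : point := fun i => (s 'X_i).@[v].

Lemma mpoly_rmorph_ext (A : nzRingType) (f g : {rmorphism {mpoly P[n]} -> A}) :
  (forall c, f c%:MP = g c%:MP) -> (forall i, f 'X_i = g 'X_i) -> f =1 g.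
Proof.
move=> fgC fgX p; elim/mpolyind: p => [|c m p _ _ IH].
  by rewrite !rmorph0.
rewrite !rmorphD IH -mul_mpolyC !rmorphM fgC mpolyXE_id; congr (_ * _ + _).
by rewrite !rmorph_prod; apply: eq_bigr => i _; rewrite !rmorphXn fgX.
Qed.

Lemma meval_act s p v : (s p).@[v] = p.@[act s v].
Proof.
pose f : {rmorphism {mpoly P[n]} -> P} := meval v \o s.
apply: (@mpoly_rmorph_ext _ f (meval (act s v))) => [c|i].
  by rewrite /f /= end_mpolyC !mevalC.
by rewrite /f /= mevalXU.
Qed.

Lemma act_inj s t : (forall v, act s v = act t v) -> s = t.
Proof.
move=> st; apply: mpoly_endP => p; apply: eq_mpoly_meval => v.
by rewrite !meval_act st.
Qed.

(** The algebra-geometry correspondence is contravariant. *)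
Lemma act_mul s t v : act (s * t)%g v = act t (act s v).
Proof. by apply/funext => i; rewrite /act /= meval_act. Qed.

Definition mpoly_subst (g : 'I_n -> {mpoly P[n]}) : mpoly_end n P :=
  comp_mpoly [tuple g i | i < n].

Lemma act_subst g v : act (mpoly_subst g) v = fun i => (g i).@[v].
Proof.
by apply/funext => i; rewrite /act /= comp_mpolyXU -tnth_nth tnth_mktuple.
Qed.

Definition const_end v : mpoly_end n P := mpoly_subst (fun i => (v i)%:MP).

Lemma act_const v w : act (const_end v) w = v.
Proof. by rewrite act_subst; apply/funext => i; rewrite mevalC. Qed.

Lemma mul_const s v : (s * const_end v)%g = const_end v.
Proof. by apply: act_inj => w; rewrite act_mul !act_const. Qed.

Lemma const_mul s v : (const_end v * s)%g = const_end (act s v).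
Proof. by apply: act_inj => w; rewrite act_mul !act_const. Qed.

Lemma right_zero_const z :
  (forall s, (s * z)%g = z) -> z = const_end (act z (fun=> 0)).
Proof.
move=> zz; apply: act_inj => w.
by rewrite act_const -[in LHS](zz (const_end (fun=> 0))) act_mul act_const.
Qed.

(** The point [v] is identified with the constant map [const_end v]. *)
Definition point_map (tau : semigroup_aut (mpoly_end n P)) v : point :=
  act (tau (const_end v)) (fun=> 0).

Lemma aut_const (tau : semigroup_aut (mpoly_end n P)) v :
  tau (const_end v) = const_end (point_map tau v).
Proof.
by apply: right_zero_const => s; rewrite -[s](autVK tau) -gmulfM mul_const.
Qed.

Lemma act_aut (tau : semigroup_aut (mpoly_end n P)) s v :
  act (tau s) (point_map tau v) = point_map tau (act s v).
Proof.
have := congr1 tau (const_mul s v); rewrite gmulfM !aut_const const_mul.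
by move=> /(congr1 (act ^~ (fun=> 0))); rewrite !act_const.
Qed.

Lemma point_mapK (tau : semigroup_aut (mpoly_end n P)) :
  cancel (point_map tau) (point_map (semigroup_aut_inv tau)).
Proof.
move=> v; rewrite /(point_map (semigroup_aut_inv tau)) -aut_const /=.
by rewrite (autK tau) act_const.
Qed.

Lemma point_mapVK (tau : semigroup_aut (mpoly_end n P)) :
  cancel (point_map (semigroup_aut_inv tau)) (point_map tau).
Proof.
move=> v; rewrite /(point_map tau) -(aut_const (semigroup_aut_inv tau)) /=.
by rewrite (autVK tau) act_const.
Qed.

End EndPoints.

(** * Polynomials along curves and under field automorphisms *)

Section MpolyCurves.
Variables (P : closedFieldType) (n : nat).

Definition along (gamma : 'I_n -> {poly P}) :
  {rmorphism {mpoly P[n]} -> {poly P}} := mmap (@polyC P) gamma.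

Lemma along_C gamma c : along gamma c%:MP = c%:P.
Proof. by rewrite /along /= mmapC. Qed.

Lemma horner_along gamma p y :
  (along gamma p).[y] = p.@[fun i => (gamma i).[y]].
Proof.
pose f : {rmorphism {mpoly P[n]} -> P} := horner_eval y \o along gamma.
apply: (@mpoly_rmorph_ext _ _ _ f (meval (fun i => (gamma i).[y]))) => [c|i].
  by rewrite /f /= /horner_eval mmapC hornerC mevalC.
by rewrite /f /= /horner_eval mmapX mmap1U mevalXU.
Qed.

Lemma meval_horner_alg (t : {mpoly P[n]}) (g : {poly P}) v :
  (horner_alg t g).@[v] = g.[t.@[v]].
Proof.
elim/poly_ind: g => [|g c IH]; first by rewrite !rmorph0 horner0.
by rewrite rmorphD rmorphM /= horner_algX horner_algC mpolyC_alg mevalD mevalM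
           IH mevalC !hornerE.
Qed.

(** A nonconstant polynomial takes infinitely many values: otherwise a product
of differences [t - c] would vanish. *)
Lemma nonconst_values (t : {mpoly P[n]}) (g : {poly P}) :
  (1 < msize t)%N -> (forall v, g.[t.@[v]] = 0) -> g = 0.
Proof.
move=> t1 gt0; apply/eqP; apply: contraTT t1 => g0.
have [s sE] := horner_alg_split t g.
have : horner_alg t g = 0.
  by apply: mpoly_eq0_meval => v; rewrite meval_horner_alg gt0.
rewrite sE mpolyC_alg => /eqP; rewrite mulf_eq0 mpolyC_eq0 lead_coef_eq0.
rewrite (negbTE g0) /= prodf_seq_eq0 => /hasP[c _] /=.
rewrite subr_eq0 mpolyC_alg => /eqP ->.
by rewrite msizeC -leqNgt; case: eqP.
Qed.

Lemma meval_map_mpoly (alpha : {rmorphism P -> P}) (p : {mpoly P[n]}) v :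
  (map_mpoly alpha p).@[alpha \o v] = alpha p.@[v].
Proof.
pose f : {rmorphism {mpoly P[n]} -> P} := meval (alpha \o v) \o map_mpoly alpha.
pose g : {rmorphism {mpoly P[n]} -> P} := alpha \o meval v.
apply: (@mpoly_rmorph_ext _ _ _ f g) => [c|i].
  by rewrite /f /g /= map_mpolyC !mevalC.
by rewrite /f /g /= map_mpolyX !mevalXU.
Qed.

End MpolyCurves.

(** * The image of a coordinate axis *)

Section Automorphism.
Variables (P : closedFieldType) (n : nat) (i0 : 'I_n).
Local Notation point := ('I_n -> P).
Variable tau : semigroup_aut (mpoly_end n P).

Definition axis (y : P) : point := fun i => if i == i0 then y else 0.
Definition to_axis (f : {mpoly P[n]}) : mpoly_end n P :=
  mpoly_subst (fun i => if i == i0 then f else 0).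

Lemma act_to_axis f v : act (to_axis f) v = axis f.@[v].
Proof.
rewrite act_subst; apply/funext => i.
by rewrite /axis; case: eqP; rewrite ?meval0.
Qed.

Lemma axis_i0 y : axis y i0 = y. Proof. by rewrite /axis eqxx. Qed.

Local Notation mu := (point_map tau).
Local Notation mu' := (point_map (semigroup_aut_inv tau)).
Local Notation muK := (@point_mapK P n tau).
Local Notation muVK := (@point_mapVK P n tau).

Lemma act_aut_conj s w : act (tau s) w = mu (act s (mu' w)).
Proof. by rewrite -act_aut muVK. Qed.

Lemma act_autV_conj s w : act (semigroup_aut_inv tau s) w = mu' (act s (mu w)).
Proof. by rewrite -(act_aut (semigroup_aut_inv tau)) muK. Qed.

Definition axis_retract : mpoly_end n P := tau (to_axis 'X_i0).
Local Notation e := axis_retract.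

Lemma act_axis_retract w : act e w = mu (axis (mu' w i0)).
Proof. by rewrite act_aut_conj act_to_axis mevalXU. Qed.

Lemma axis_retract_idem p : e (e p) = e p.
Proof.
apply: eq_mpoly_meval => v; rewrite !meval_act; congr (_.@[_]).
by rewrite !act_axis_retract muK axis_i0.
Qed.

(** The segment joining two points of [mu(axis)], pushed into [mu(axis)] by the
retraction: a polynomial curve in a set not yet known to be polynomially
parametrised. *)
Definition chord (i : 'I_n) : {poly P} :=
  (mu (axis 0) i)%:P + (mu (axis 1) i - mu (axis 0) i)%:P * 'X.
Definition arc (i : 'I_n) : {poly P} := along chord (e 'X_i).

Lemma arc_axis s : exists y, (fun i => (arc i).[s]) = mu (axis y).
Proof.
pose w i := (chord i).[s]; exists (mu' w i0); rewrite -act_axis_retract.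
by apply/funext => i; rewrite /arc horner_along.
Qed.

Lemma arc_nonconst : exists j, (arc j).[0] != (arc j).[1].
Proof.
have arc0 j : (arc j).[0] = mu (axis 0) j.
  rewrite /arc horner_along meval_act mevalXU.
  have -> : (fun i => (chord i).[0]) = mu (axis 0).
    by apply/funext => i; rewrite !hornerE.
  by rewrite act_axis_retract muK axis_i0.
have arc1 j : (arc j).[1] = mu (axis 1) j.
  rewrite /arc horner_along meval_act mevalXU.
  have -> : (fun i => (chord i).[1]) = mu (axis 1).
    apply/funext => i.
    by rewrite /chord hornerD hornerM !hornerC hornerX mulr1 addrC subrK.
  by rewrite act_axis_retract muK axis_i0.
apply: contrapT => /forallNP arc01.
have /(can_inj muK)/(congr1 (@^~ i0)) : mu (axis 0) = mu (axis 1).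
  by apply/funext => j; have := arc01 j; rewrite arc0 arc1 => /negP/negPn/eqP.
by rewrite !axis_i0 => /eqP; rewrite eq_sym oner_eq0.
Qed.

(** Transporting [r] by the inverse of [tau] gives polynomials [D i] in one
variable whose common zeros are the parameters on the axis of the zeros of [r]
on [mu(axis)].  If some [D i] were nonzero, these zeros would be finitely many,
whereas the arc, being nonconstant, has infinitely many points. *)
Lemma along_arc_inj r : e r = r -> along arc r = 0 -> r = 0.
Proof.
move=> er r0.
pose G := semigroup_aut_inv tau (to_axis r).
have GE y : act G (axis y) = mu' (axis r.@[mu (axis y)]).
  by rewrite act_autV_conj act_to_axis.
pose axisp (i : 'I_n) : {poly P} := if i == i0 then 'X else 0.
have axispE y : (fun i => (axisp i).[y]) = axis y.
  by apply/funext => i; rewrite /axisp /axis; case: eqP; rewrite !hornerE.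
pose D i := along axisp (G 'X_i) - (mu' (axis 0) i)%:P.
have DE i y : (D i).[y] = mu' (axis r.@[mu (axis y)]) i - mu' (axis 0) i.
  by rewrite /D !hornerE horner_along axispE -GE.
have [D0|/existsNP[i /eqP Di]] := EM (forall i, D i = 0).
  have rmu y : r.@[mu (axis y)] = 0.
    rewrite -[LHS]axis_i0.
    suff -> : axis r.@[mu (axis y)] = axis 0 by rewrite axis_i0.
    apply: (can_inj muVK); apply/funext => i; apply/eqP.
    by rewrite -subr_eq0 -DE D0 horner0.
  by apply: mpoly_eq0_meval => v; rewrite -er meval_act act_axis_retract.
have [s sE] := closed_field_poly_normal (D i).
have [j /negP[]] := arc_nonconst.
have : \prod_(a <- s) (arc j - (mu (axis a) j)%:P) = 0.
  apply: poly_eq0_horner => z; rewrite horner_prod.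
  have [y yE] := arc_axis z.
  have : root (D i) y.
    rewrite /root DE; move/(congr1 (horner^~ z)): r0.
    by rewrite horner_along yE horner0 => ->; rewrite subrr.
  rewrite sE rootZ ?lead_coef_eq0 // root_prod_XsubC => ys.
  rewrite (big_rem y) //= !hornerE (_ : (arc j).[z] = mu (axis y) j).
    by rewrite subrr mul0r.
  by rewrite -yE.
move=> /eqP; rewrite prodf_seq_eq0 => /hasP[a _ /=].
by rewrite subr_eq0 => /eqP ->; rewrite !hornerC.
Qed.

Lemma axis_retract_dep f r :
  e f = f -> e r = r -> exists2 S, S != 0 & eval2 f r S = 0.
Proof.
move=> ef er.
have [S S0 SE] := poly_algebraic_dependence (along arc f) (along arc r).
exists S => //; apply: along_arc_inj.
  rewrite (eval2_morph (g := e)); last first.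
    by move=> c; rewrite mpolyC_alg /= end_mpolyC.
  by congr (eval2 _ _ _); [exact: ef|exact: er].
rewrite eval2_morph // => c.
by rewrite mpolyC_alg along_C -mul_polyC mulr1.
Qed.

(** Take for [t] a generator of the ring of functions on [mu(axis)] and for
[phi] the expressions in [t] of the coordinates of the retraction.  As the
retraction fixes [t], the composite [t \o phi] is the identity on the values of
[t], which are infinitely many. *)
Lemma axis_section : exists (t : {mpoly P[n]}) (phi : 'I_n -> {poly P}),
  (forall y, t.@[fun i => (phi i).[y]] = y) /\
  (forall w, act e w = fun i => (phi i).[t.@[w]]).
Proof.
have [j0 j0P] := arc_nonconst.
have nc : (1 < msize (e 'X_j0))%N.
  rewrite ltnNge; apply: contra j0P => /msize1_polyC.
  by rewrite /arc => ->; rewrite along_C !hornerC.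
have [t [et t1 tgen]] :=
  retract_generator axis_retract_idem axis_retract_dep
    (axis_retract_idem 'X_j0) nc.
have /choice[phi phiE] : forall i, exists g, e 'X_i = horner_alg t g.
  by move=> i; exact/tgen/axis_retract_idem.
have act_phi w : act e w = fun i => (phi i).[t.@[w]].
  by apply/funext => i; rewrite /act phiE meval_horner_alg.
exists t, phi; split=> // y.
suff /eqP : along phi t - 'X = 0.
  by rewrite subr_eq0 -horner_along => /eqP ->; rewrite hornerX.
apply: (nonconst_values t1) => v; rewrite !hornerE horner_along -act_phi.
by rewrite -meval_act et subrr.
Qed.

(** * Every automorphism is semi-inner *)

(** Composing with [phi], resp. [axis], turns a scalar function into an
endomorphism to which the inverse of [tau], resp. [tau], applies; reading the
result through the coordinate on the axis, resp. [t], shows that [beta \o mu]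
and [mu' \o alpha] are polynomial, where [beta] is the inverse of [alpha]. *)
Lemma aut_semi_inner : semi_inner tau.
Proof.
have [t [phi [t_phi act_phi]]] := axis_section.
pose phip y : point := fun i => (phi i).[y].
have act_phip w : mu (axis (mu' w i0)) = phip t.@[w].
  by rewrite -act_axis_retract act_phi.
pose nu y := t.@[mu (axis y)]; pose nu' y := mu' (phip y) i0.
have mu_axis y : mu (axis y) = phip (nu y).
  by rewrite -[in RHS]/(nu y) -act_phip muK axis_i0.
have nuK : cancel nu nu' by move=> y; rewrite /nu' -mu_axis muK axis_i0.
have nu'K : cancel nu' nu.
  by move=> y; rewrite /nu /nu' act_phip /phip !t_phi.
have muV_phip y : mu' (phip y) = axis (nu' y).
  by rewrite -{1}[y]nu'K -mu_axis muK.
have nu_poly (g : {poly P}) :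
    exists g' : {poly P}, forall y, nu g.[y] = g'.[nu y].
  exists (along phi (tau (to_axis (horner_alg 'X_i0 g)) t)) => y.
  rewrite horner_along -/(phip (nu y)) -mu_axis meval_act act_aut act_to_axis.
  by rewrite meval_horner_alg mevalXU axis_i0.
have [alpha [a [b [a0 nuE]]]] := conj_poly_semi_affine nuK nu'K nu_poly.
pose alpha' y := nu' (a * y + b).
have alphaK : cancel alpha alpha' by move=> y; rewrite /alpha' -nuE nuK.
have alpha'K : cancel alpha' alpha.
  move=> y; apply: (mulfI a0); apply: (addIr b); rewrite -nuE /alpha' nu'K //.
have [beta betaE] : exists beta : {rmorphism P -> P}, alpha' =1 beta.
  apply: rmorphism_of_morph => [x y|x y|].
  - by apply: (can_inj alphaK); rewrite rmorphD !alpha'K.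
  - by apply: (can_inj alphaK); rewrite rmorphM !alpha'K.
  - by apply: (can_inj alphaK); rewrite rmorph1 !alpha'K.
have {}alphaK : cancel alpha beta by move=> y; rewrite -betaE alphaK.
have betaK : cancel beta alpha by move=> y; rewrite -betaE alpha'K.
(* K represents the map beta \o mu *)
pose sK i : mpoly_end n P := mpoly_subst (fun k => horner_alg 'X_i (phi k)).
have act_sK i w : act (sK i) w = phip (w i).
  by rewrite act_subst; apply/funext => k; rewrite meval_horner_alg mevalXU.
pose K i : {mpoly P[n]} :=
  beta a *: semigroup_aut_inv tau (sK i) 'X_i0 + (beta b)%:MP.
have KE w i : alpha (K i).@[w] = mu w i.
  rewrite mevalD mevalZ mevalC -/(act (semigroup_aut_inv tau (sK i)) w i0).
  rewrite act_autV_conj act_sK muV_phip axis_i0 rmorphD rmorphM !betaK.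
  by rewrite -nuE nu'K.
(* Q represents alpha \o mu', and H below represents mu' \o alpha *)
pose Q i : {mpoly P[n]} := a^-1 *: (tau (to_axis 'X_i) t - b%:MP).
have QE w i : (Q i).@[w] = alpha (mu' w i).
  rewrite mevalZ mevalB mevalC meval_act act_aut_conj act_to_axis mevalXU.
  by rewrite -/(nu _) nuE addrK mulKf.
pose H i := map_mpoly beta (Q i).
have HE v i : (H i).@[v] = mu' (alpha \o v) i.
  have vE : v = beta \o (alpha \o v) by apply/funext => k; rewrite /= alphaK.
  by rewrite {1}vE meval_map_mpoly QE alphaK.
pose eta := mpoly_subst H; pose eta' := mpoly_subst K.
have act_eta v : act eta v = mu' (alpha \o v).
  by rewrite act_subst; apply/funext => i; rewrite HE.
have act_eta' w : alpha \o act eta' w = mu w.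
  by rewrite act_subst; apply/funext => i; rewrite /= KE.
have etaK : cancel eta eta'.
  move=> p; apply: eq_mpoly_meval => w; rewrite !meval_act act_eta act_eta'.
  by rewrite muK.
have eta'K : cancel eta' eta.
  move=> p; apply: eq_mpoly_meval => v; rewrite !meval_act act_eta.
  congr (_.@[_]); apply/funext => i; apply: (can_inj alphaK).
  by rewrite -[LHS]/((alpha \o act eta' _) i) act_eta' muVK.
have map_alphaK : cancel (@map_mpoly n _ _ alpha) (map_mpoly beta).
  by move=> p; apply/mpolyP => m; rewrite !mcoeff_map_mpoly /= alphaK.
have map_betaK : cancel (@map_mpoly n _ _ beta) (map_mpoly alpha).
  by move=> p; apply/mpolyP => m; rewrite !mcoeff_map_mpoly /= betaK.
exists alpha, eta; split; first by exists beta.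
  exact: (Bijective etaK eta'K).
exists (eta' \o map_mpoly beta); split.
- by move=> p; rewrite /= map_alphaK etaK.
- by move=> p; rewrite /= eta'K map_betaK.
move=> s p; apply: eq_mpoly_meval => w /=.
have wE : w = alpha \o (beta \o w) by apply/funext => i; rewrite /= betaK.
rewrite [in RHS]wE meval_map_mpoly !meval_act act_eta -wE.
set x := act s _; have -> : act eta' x = beta \o mu x.
  by apply/funext => i; apply: (can_inj alphaK); rewrite /= betaK -act_eta'.
by rewrite meval_map_mpoly betaK act_aut_conj.
Qed.

End Automorphism.

Theorem theorem3 (P : closedFieldType) (n : nat) (hn : (0 < n)%N)
    (tau : semigroup_aut (mpoly_end n P)) :
  generated (@semi_inner n P) tau.
Proof.
by move=> H _; apply; apply: (aut_semi_inner (Ordinal hn)).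
Qed.
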